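(* Let $\Omega$ be a Polish space, $\mu$ a probability measure on $\Omega$, and $\lambda$ a strictly positive continuous function on $(0,\infty)$ with $\int_0^\infty \min\{1,t\}\lambda(t)\,dt<\infty$. Let $N$ be the random measure on $\Omega$ constructed from $(\lambda,\mu)$ as in the context, and let $M_0$ and $M$ be random measures on $\Omega$ that are both weighted versions of $N$, i.e. $\mathbb{P}(M_0\in dm)=h_0(m(\Omega))\,\mathbb{P}(N\in dm)$ and $\mathbb{P}(M\in dm)=h(m(\Omega))\,\mathbb{P}(N\in dm)$ for some non-negative measurable functions $h_0,h$ with $\mathbb{E}[h_0(N(\Omega))]=\mathbb{E}[h(N(\Omega))]=1$. Let $\psi(s):=-\log\mathbb{E}[e^{-sM_0(\Omega)}]$ be the cumulant function of $M_0(\Omega)$, fix $\nu>0$ such that $\mathbb{E}[M_0(\Omega)^{-\nu}]<\infty$, and let $\xi$ be a positive random variable defined on the same probability space as $M$. Then the three properties (i) $M$ and $\xi M(\Omega)$ are stochastically independent, (ii) $\xi M(\Omega)$ has the $\mathrm{Gamma}(\nu,1)$ distribution, (iii) $M(\Omega)$ is equal in distribution to $M_0(\Omega)^{[\nu]}$, all hold if and only if $$\mathbb{P}(\xi\in ds)=\frac{e^{-\psi(s)}s^{\nu-1}}{\mathbb{E}[M_0(\Omega)^{-\nu}]\,\Gamma(\nu)}\,ds\quad(s>0)\qquad\text{and}\qquad M\,|\,(\xi=s)\ \overset{d}{=}\ M_0^{(s)}\ \text{ for almost every } s>0.$$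
   Context: Construction of $N$: let $(J_n,\omega_n)_n$ be the points of a Poisson process on $(0,\infty)\times\Omega$ with mean measure $\lambda(t)\,dt\,\mu(d\omega)$, and set $N:=\sum_n J_n\delta_{\omega_n}$; then $N(\Omega)<\infty$ almost surely. Exponential tilt of a random measure: for $s\ge 0$, $M_0^{(s)}$ is a random measure with law $\mathbb{P}(M_0^{(s)}\in dm)=e^{\psi(s)-s\,m(\Omega)}\,\mathbb{P}(M_0\in dm)$, where $\psi$ is the cumulant function of $M_0(\Omega)$. Polynomial tilt of a scalar variable: for a positive random variable $Y$ with $\mathbb{E}[Y^{-\nu}]<\infty$, $Y^{[\nu]}$ is a random variable with law $\mathbb{P}(Y^{[\nu]}\in dt)=\frac{t^{-\nu}}{\mathbb{E}[Y^{-\nu}]}\mathbb{P}(Y\in dt)$. $M\,|\,(\xi=s)$ denotes the regular conditional law of $M$ given $\xi=s$. $\mathrm{Gamma}(\nu,1)$ has density $t^{\nu-1}e^{-t}/\Gamma(\nu)$ on $(0,\infty)$. *)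

(* Defs.v *)
From HB Require Import structures.
From mathcomp Require Import all_boot all_order all_algebra.
From mathcomp Require Import all_classical all_reals all_analysis measurable_realfun.

Set Implicit Arguments.
Unset Strict Implicit.
Unset Printing Implicit Defensive.

Import Order.TTheory GRing.Theory Num.Theory.
Import numFieldNormedType.Exports.

Local Open Scope classical_set_scope.
Local Open Scope ring_scope.

(* The metric is existentially quantified: only the topology of X is fixed. *)
Definition polish_space (R : realType) (X : topologicalType) : Prop :=
  (exists2 D : set X, countable D & dense D) /\
  exists d : X -> X -> R,
    [/\ (forall x y, (d x y = 0) <-> (x = y)),
        (forall x y, d x y = d y x) /\
          (forall x y z, d x z <= d x y + d y z),
        (forall x : X, nbhs x =
           filter_from [set e : R | 0 < e] (fun e => [set y | d x y < e]))
      & forall u : nat -> X,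
          (forall e : R, 0 < e -> exists n : nat, forall i j : nat,
             (n <= i)%N -> (n <= j)%N -> d (u i) (u j) < e) ->
          exists l : X, u @ \oo --> l].

Definition borel (X : ptopologicalType) := g_sigma_algebraType (@open X).

Section finite_measures.
Context d (X : measurableType d) (R : realType).

Definition fmeas : Type := {finite_measure set X -> \bar R}.

HB.instance Definition _ := gen_eqMixin fmeas.
HB.instance Definition _ := gen_choiceMixin fmeas.
HB.instance Definition _ := isPointed.Build fmeas (@mzero d X R).

Definition fmeas_ev (A : set X) (m : fmeas) : \bar R := m A.

(* The sigma-algebra on finite measures generated by m |-> m A, A measurable. *)
Definition fmeas_cylinder : set (set fmeas) :=
  \bigcup_(A in @measurable _ X)
    preimage_set_system [set: fmeas] (fmeas_ev A) (@measurable _ (\bar R)).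

Definition fmeasT : measurableType fmeas_cylinder.-sigma :=
  g_sigma_algebraType fmeas_cylinder.

Definition mass (m : fmeasT) : R := fine (fmeas_ev setT m).

Lemma measurable_fmeas_ev (A : set X) : measurable A ->
  measurable_fun [set: fmeasT] (fmeas_ev A : fmeasT -> \bar R).
Proof.
move=> mA _ B mB; apply: sub_sigma_algebra; exists A => //.
by exists B.
Qed.

Lemma measurable_mass : measurable_fun [set: fmeasT] mass.
Proof.
apply: measurableT_comp; first exact: fine_measurable.
exact: measurable_fmeas_ev.
Qed.

HB.instance Definition _ :=
  isMeasurableFun.Build _ _ fmeasT R mass measurable_mass.

End finite_measures.

(* Q(dx) = f(x) P(dx) *)
Definition has_density d (E : measurableType d) (R : realType)
    (Q : set E -> \bar R) (P : {measure set E -> \bar R}) (f : E -> \bar R) :=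
  forall A : set E, measurable A -> Q A = (\int[P]_(x in A) f x)%E.

(* Q(dx) = f(x) dx *)
Definition has_pdf (R : realType) (Q : set R -> \bar R) (f : R -> R) :=
  forall A : set R, measurable A ->
    Q A = (\int[lebesgue_measure]_(x in A) (f x)%:E)%E.

Section poisson_process.
Local Open Scope ereal_scope.
Context dT (T : measurableType dT) (R : realType) (P : probability T R).
Context dE (E : measurableType dE).

(* An at most countable random family of points: the n-th point pt n exists on
   the event D n only. *)
Variables (D : nat -> set T) (pt : nat -> T -> E).

Definition count (A : set E) (t : T) : \bar R :=
  \sum_(0 <= n <oo) (\1_(D n `&` pt n @^-1` A) t)%:E.

Definition poisson_process (m : set E -> \bar R) : Prop :=
  [/\ forall n, measurable (D n) /\ measurable_fun (D n) (pt n),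
      forall A, measurable A -> m A < +oo -> forall k : nat,
        P (count A @^-1` [set k%:R%:E]) =
          (fine (m A) ^+ k / (k`!)%:R * expR (- fine (m A)))%:E,
      forall A, measurable A -> m A = +oo -> P (count A @^-1` [set +oo]) = 1
    & forall (k : nat) (A : 'I_k -> set E) (B : 'I_k -> set (\bar R)),
        (forall i, measurable (A i)) -> trivIset [set: 'I_k] A ->
        (forall i, measurable (B i)) ->
        P (\bigcap_i (count (A i) @^-1` B i)) =
          \prod_(i < k) P (count (A i) @^-1` B i)].

End poisson_process.

(* lam(t) dt mu(dw) on (0, +oo) x W *)
Definition intensity d (W : measurableType d) (R : realType) (lam : R -> R)
    (mu : probability W R) (A : set (R * W)) : \bar R :=
  (\int[lebesgue_measure \x mu]_(x in A `&` (`]0%R, +oo[ `*` setT))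
     (lam x.1)%:E)%E.

Section random_measures.
Local Open Scope ereal_scope.
Context dT (T : measurableType dT) (R : realType) (P : probability T R).
Context dW (W : measurableType dW).

Definition total_mass (M : {RV P >-> fmeasT W R}) : {RV P >-> R} :=
  @mass dW W R \o M.

(* N = \sum_n J_n \d_(w_n) almost surely, where (J_n, w_n)_n are the points of a
   Poisson process with intensity lam(t) dt mu(dw). *)
Definition poisson_random_measure (lam : R -> R) (mu : probability W R)
    (N : {RV P >-> fmeasT W R}) : Prop :=
  exists (D : nat -> set T) (J : nat -> T -> R) (w : nat -> T -> W),
    [/\ poisson_process P D (fun n t => (J n t, w n t)) (intensity lam mu),
        forall n t, D n t -> (0 < J n t)%R
      & {ae P, forall t, forall B : set W, measurable B ->
          fmeas_ev B (N t) =
            \sum_(0 <= n <oo) (J n t * \1_(D n) t * \1_B (w n t))%:E}].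

End random_measures.

Definition weighted_version dT (T : measurableType dT) dT' (T' : measurableType dT')
    dW (W : measurableType dW) (R : realType)
    (P : probability T R) (P' : probability T' R)
    (h : R -> R) (M : {RV P >-> fmeasT W R}) (N : {RV P' >-> fmeasT W R}) : Prop :=
  has_density (distribution P M) (distribution P' N) (fun m => (h (mass m))%:E).

Definition independent_rv dT (T : measurableType dT) (R : realType)
    (P : probability T R) d1 (E1 : measurableType d1) d2 (E2 : measurableType d2)
    (X : T -> E1) (Y : T -> E2) : Prop :=
  forall A B, measurable A -> measurable B ->
    (P (X @^-1` A `&` Y @^-1` B) = P (X @^-1` A) * P (Y @^-1` B))%E.

Definition Gamma_fun (R : realType) (nu : R) : R :=
  fine (\int[lebesgue_measure]_(t in `]0%R, +oo[)
          (t `^ (nu - 1) * expR (- t))%:E)%E.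

Definition gamma_pdf (R : realType) (nu t : R) : R :=
  if 0 < t then t `^ (nu - 1) * expR (- t) / Gamma_fun nu else 0.

Section scalar_variables.
Context dT (T : measurableType dT) (R : realType) (P : probability T R).

Definition cumulant (Y : T -> R) (s : R) : R :=
  - ln (fine ('E_P[fun t => expR (- s * Y t)])%E).

(* y^(-nu) for y >= 0 and nu > 0, with value +oo at y = 0 *)
Definition negpow (nu y : R) : \bar R := ((y `^ nu)%:E^-1)%E.

Definition neg_moment (nu : R) (Y : T -> R) : \bar R :=
  (\int[P]_t negpow nu (Y t))%E.

(* the law of Y^[nu] *)
Definition poly_tilt (nu : R) (Y : {RV P >-> R}) (A : set R) : \bar R :=
  (\int[distribution P Y]_(t in A)
     (negpow nu t * ((fine (neg_moment nu Y))^-1)%:E))%E.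

Definition exp_tilt dW (W : measurableType dW) (M : {RV P >-> fmeasT W R})
    (s : R) (A : set (fmeasT W R)) : \bar R :=
  (\int[distribution P M]_(m in A)
     (expR (cumulant (total_mass M) s - s * mass m))%:E)%E.

Definition regular_cond_law dE (E : measurableType dE)
    (X : {RV P >-> E}) (xi : {RV P >-> R}) (kappa : R.-pker R ~> E) : Prop :=
  forall A B, measurable A -> measurable B ->
    P (X @^-1` A `&` xi @^-1` B) =
      (\int[distribution P xi]_(s in B) kappa s A)%E.

End scalar_variables.

(* Main.v *)
Require Import Defs.
From HB Require Import structures.
From mathcomp Require Import all_boot all_order all_algebra.
From mathcomp Require Import all_classical all_reals all_analysis measurable_realfun.
From mathcomp Require Import ring.

Import Order.TTheory GRing.Theory Num.Theory.
Import numFieldNormedType.Exports.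
Local Open Scope classical_set_scope.
Local Open Scope ring_scope.

(** Only the total size of the random measures matters.  Let [P] be the law of
    [M_0], [w] the total mass, [c = E[M_0(Omega)^-nu]], [X = M] and
    [Z = xi * w X].

    Properties (i)-(iii) together fix the joint law of [(X, Z)]: it is the
    product of the tilted law [w(x)^-nu / c P(dx)] and of the gamma law.  For
    this, (iii), which only speaks of the law of [w X], has to be lifted to the
    law of [X].  This is possible because the laws of [M] and [M_0] both have
    densities with respect to the law of [N] that are functions of the size;
    such densities are determined by the law of the size
    ([has_density_lift]).

    The claimed law of [xi] together with the conditional law of [X] given [xi]
    fixes the joint law of [(X, xi)]: after the normalisations [exp (- psi s)]
    and [exp (psi s)] cancel, its density with respect to [P(dx) ds] on [s > 0]
    is [s^(nu-1) exp (- s w(x)) / (c Gamma(nu))]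
    ([conditional_law_mixtureP]).

    These two joint laws are images of one another under the bijection
    [(x, s) |-> (x, s w(x))] of [{w > 0} * R]: substituting [z = s w(x)] turns
    [z^(nu-1) exp(-z) dz] into [w(x)^nu s^(nu-1) exp(- s w(x)) ds], and the
    factor [w(x)^nu] cancels the polynomial tilt ([tilted_gamma_unscale]).  As
    rectangles determine finite measures on a product, either description
    yields the other ([gamma_mixtureP]); that [w X] does not vanish, almost
    surely, follows from each of them.

    Either side of the equivalence forces [c * Gamma(nu) != 0], since the
    density of a probability law cannot vanish identically
    ([scaled_size_gammaP]). *)

Set Implicit Arguments.
Unset Strict Implicit.
Unset Printing Implicit Defensive.

(** * Integration against densities *)

Lemma lebesgue_measure_below (R : realType) (y : \bar R) : (0 <= y)%E ->
  lebesgue_measure [set t : R | 0 <= t /\ (t%:E < y)%E] = y.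
Proof.
case: y => [y| |//].
- rewrite lee_fin => y0.
  rewrite (_ : [set _ | _] = `[0, y[%classic); last first.
    by apply/seteqP; split => t /=; rewrite in_itv/= lte_fin => /andP.
  rewrite lebesgue_measure_itv/= lte_fin; case: ifPn => [_|].
    by rewrite sube0.
  by rewrite -leNgt => y_le0; congr (_%:E); apply/eqP; rewrite eq_le y0.
- move=> _; rewrite (_ : [set _ | _] = `[0, +oo[%classic); last first.
    by apply/seteqP; split => t /=; rewrite in_itv/= andbT ltry => // -[].
  by rewrite lebesgue_measure_itv/= ltry.
Qed.

(** Layer cake: [g x] is the length of [{t >= 0 | t < g x}], so by Tonelli both
    sides are integrals over [t] of the [Q]-measures of the level sets
    [{g > t}], where the density applies directly. *)
Lemma ge0_integral_density d (E : measurableType d) (R : realType)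
    (Q P : {sigma_finite_measure set E -> \bar R}) (f : E -> R) (D : set E)
    (g : E -> \bar R) :
  measurable_fun setT f -> (forall x, 0 <= f x) ->
  has_density Q P (EFin \o f) ->
  measurable D -> measurable_fun D g -> (forall x, 0 <= g x)%E ->
  (\int[Q]_(x in D) g x = \int[P]_(x in D) (g x * (f x)%:E))%E.
Proof.
move=> mf f0 QP mD mg g0; rewrite integral_mkcond [RHS]integral_mkcond.
have mgD : measurable_fun setT (g \_ D) by exact/(measurable_restrictT _ mD).1.
have gD0 x : (0 <= (g \_ D) x)%E by rewrite patchE; case: ifPn.
pose S : set (E * measurableTypeR R) :=
  [set z | 0 <= z.2 /\ (z.2%:E < (g \_ D) z.1)%E].
have mS : measurable S.
  have mleb : measurable_fun setT (fun z : E * measurableTypeR R => (z.2 : R)).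
    exact: measurable_snd.
  rewrite (_ : S = (setT `&` [set z | (0%:E <= z.2%:E)%E]) `&`
      (setT `&` [set z | (z.2%:E < (g \_ D) z.1)%E])); last first.
    by apply/seteqP; split => z; rewrite !setTI /S/= lee_fin.
  apply: measurableI.
  - by apply: measurable_lee => //; exact/measurable_EFinP.
  - apply: measurable_lte => //; first exact/measurable_EFinP.
    exact: (measurableT_comp mgD measurable_fst).
pose K (z : E * measurableTypeR R) : \bar R := (\1_S z)%:E.
have mK : measurable_fun setT K by exact/measurable_EFinP.
have mKf : measurable_fun setT (fun z => K z * (f z.1)%:E)%E.
  apply: emeasurable_funM => //; apply/measurable_EFinP.
  exact: (measurableT_comp mf measurable_fst).
have KE x : (\int[lebesgue_measure]_t K (x, t) = (g \_ D) x)%E.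
  have mSx : measurable (xsection S x) by exact: measurable_xsection.
  have Sx : xsection S x = [set t | 0 <= t /\ (t%:E < (g \_ D) x)%E].
    by apply/seteqP; split => t; rewrite /xsection/= inE.
  rewrite -[RHS]lebesgue_measure_below// -Sx -(setIT (xsection S x)).
  rewrite -integral_indic//; apply: eq_integral => t _.
  by rewrite /K !indicE mem_xsection.
transitivity (\int[Q]_x \int[lebesgue_measure]_t K (x, t))%E.
  by apply: eq_integral => x _; rewrite KE.
transitivity (\int[P]_x \int[lebesgue_measure]_t (K (x, t) * (f x)%:E))%E;
  last first.
  apply: eq_integral => x _; rewrite ge0_integralZr//.
  - by rewrite KE !patchE; case: ifPn => // _; rewrite mul0e.
  - exact: (measurableT_comp mK (pair1_measurable x)).
  - by move=> t _; rewrite lee_fin.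
  - by rewrite lee_fin.
transitivity (\int[lebesgue_measure]_t \int[Q]_x K (x, t))%E.
  by apply: (@fubini_tonelli _ _ E (measurableTypeR R) R Q lebesgue_measure K)
    => // z; rewrite lee_fin.
transitivity (\int[lebesgue_measure]_t \int[P]_x (K (x, t) * (f x)%:E))%E;
  last first.
  apply/esym; apply: (@fubini_tonelli _ _ E (measurableTypeR R) R P
    lebesgue_measure (fun z => K z * (f z.1)%:E)%E) => // z.
  by rewrite mule_ge0 ?lee_fin.
apply: eq_integral => t _.
have mSt : measurable (ysection S t) by exact: measurable_ysection.
transitivity (Q (ysection S t)).
  rewrite -(setIT (ysection S t)) -integral_indic//.
  apply: eq_integral => x _.
  by rewrite /K !indicE mem_ysection.
rewrite QP// integral_mkcond; apply: eq_integral => x _.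
by rewrite epatch_indic/= muleC /K !indicE mem_ysection.
Qed.

(** The proofs are arguments of the definition, so that the probability
    structure can be attached to it. *)
Section density_prob.
Context d (E : measurableType d) (R : realType) (P : {measure set E -> \bar R}).
Variables (f : E -> R) (mf : measurable_fun setT f).
Hypothesis f_ge0 : forall x, 0 <= f x.
Hypothesis f1 : (\int[P]_x (f x)%:E = 1)%E.

Definition density_prob of measurable_fun setT f & (forall x, 0 <= f x)
  & (\int[P]_x (f x)%:E = 1)%E :=
  fun A : set E => (\int[P]_(x in A) (f x)%:E)%E.

Local Notation Q := (density_prob mf f_ge0 f1).

Let Q0 : Q set0 = 0%E. Proof. exact: integral_set0. Qed.

Let Q_ge0 A : (0 <= Q A)%E.
Proof. by apply: integral_ge0 => x _; rewrite lee_fin. Qed.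

Let Q_sigma_additive : semi_sigma_additive Q.
Proof.
apply: semi_sigma_additive_nng_induced; first exact/measurable_EFinP.
by move=> x; rewrite lee_fin.
Qed.

HB.instance Definition _ := isMeasure.Build _ _ _ Q Q0 Q_ge0 Q_sigma_additive.

HB.instance Definition _ := Measure_isProbability.Build _ _ _ Q f1.

End density_prob.

(** The law of a real random variable and Lebesgue measure live on two
    presentations of the Borel sigma-algebra of [R] that are not the same as
    structures; the integral is moved across by passing through the underlying
    probability space. *)
Lemma ge0_integral_pdf d (T : measurableType d) (R : realType)
    (P : probability T R) (xi : {RV P >-> R}) (f : R -> R) (B : set R)
    (g : R -> \bar R) :
  measurable_fun setT f -> (forall s, 0 <= f s) ->
  has_pdf (distribution P xi) f ->
  measurable B -> measurable_fun B g -> (forall s, 0 <= g s)%E ->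
  (\int[distribution P xi]_(s in B) g s =
   \int[lebesgue_measure]_(s in B) (g s * (f s)%:E))%E.
Proof.
move=> mf f0 xipdf mB mg g0.
have mxi : measurable_fun setT xi by [].
rewrite ge0_integral_pushforward//.
have mxi' : @measurable_fun _ _ T (measurableTypeR R) setT xi by exact: mxi.
have mg' : @measurable_fun _ _ (measurableTypeR R) _ B g by exact: mg.
have mB' : @measurable _ (measurableTypeR R) B by exact: mB.
pose xi' : {mfun T >-> measurableTypeR R} :=
  HB.pack (xi : T -> R) (isMeasurableFun.Build _ _ _ _ _ mxi').
pose law : probability (measurableTypeR R) R := distribution P xi'.
rewrite -(@ge0_integral_density _ (measurableTypeR R) R law
  lebesgue_measure f B g mf f0)//.
by rewrite /law /distribution ge0_integral_pushforward.
Qed.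

Lemma pushforward_density_neq0 d (T : measurableType d) (R : realType)
    (P : probability T R) d' (E : measurableType d')
    (m : {measure set E -> \bar R}) (Z : T -> E) (f : E -> \bar R) :
  (forall x, f x = 0%E) -> ~ has_density (pushforward P Z) m f.
Proof.
move=> f0 /(_ setT measurableT).
rewrite integral0_eq; last by move=> x _; exact: f0.
rewrite /pushforward preimage_setT => P0.
by have := probability_setT P; rewrite [LHS]P0 => /esym/eqP; rewrite onee_eq0.
Qed.

(** * Scaling of Lebesgue measure, equality of measures *)

Lemma ge0_integral_scale (R : realType) (a : R) (f : R -> \bar R) :
  0 < a -> measurable_fun setT f -> (forall x, 0 <= f x)%E ->
  (\int[lebesgue_measure]_z f z =
   a%:E * \int[lebesgue_measure]_s f (s * a)%R)%E.
Proof.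
move=> a0 mf f0.
pose ma : {nonneg R} := NngNum (ltW a0).
have mphi : measurable_fun setT
    (fun s : measurableTypeR R => s * a : measurableTypeR R).
  exact: mulrr_measurable.
pose phi : {mfun measurableTypeR R >-> measurableTypeR R} :=
  HB.pack (fun s : measurableTypeR R => s * a : measurableTypeR R)
    (isMeasurableFun.Build _ _ _ _ _ mphi).
have E A : measurable A ->
    lebesgue_measure A = mscale ma (pushforward (@lebesgue_measure R) phi) A.
  apply: lebesgue_measure_unique => _ [[x y]] _ <-.
  have pre : phi @^-1` `]x, y]%classic = `]x / a, y / a]%classic.
    apply/seteqP; split => s /=; rewrite !in_itv/=;
      by rewrite ltr_pdivrMr// ler_pdivlMr.
  transitivity
    (a%:E * lebesgue_measure (`]x / a, y / a]%classic : set R)%R)%E; last first.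
    by rewrite -pre.
  rewrite !lebesgue_measure_itv/= !lte_fin ltr_pM2r ?invr_gt0//.
  case: ifPn => _; last by rewrite mule0.
  by rewrite -!EFinB -EFinM -mulrBl mulrCA divff ?mulr1// gt_eqF.
rewrite (@eq_measure_integral _ _ _ _
  (mscale ma (pushforward (@lebesgue_measure R) phi))); last first.
  by move=> A mA _; exact: E.
rewrite ge0_integral_mscale//.
by rewrite ge0_integral_pushforward.
Qed.

(** Rectangles are stable under intersection and generate the product
    sigma-algebra. *)
Lemma eq_probability_prod d1 d2 (E : measurableType d1) (F : measurableType d2)
    (R : realType) (P : probability (E * F)%type R)
    (Q : {measure set (E * F)%type -> \bar R}) :
  (forall A B, measurable A -> measurable B -> P (A `*` B) = Q (A `*` B)) ->
  forall C, measurable C -> P C = Q C.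
Proof.
move=> PQ C mC.
pose G : set (set (E * F)) :=
  [set C | exists A, measurable A /\ exists B, measurable B /\ C = A `*` B].
apply: (measure_unique G (fun=> setT)) => //.
- rewrite measurable_prod_measurableType //; congr (<<s _ >>).
  rewrite predeqE; split => [[A mA [B mB <-]]|[A [mA [B [mB ->]]]]].
    by exists A; split => //; exists B.
  by exists A => //; exists B.
- move=> _ _ [X1 [mX1 [X2 [mX2 ->]]]] [Y1 [mY1 [Y2 [mY2 ->]]]].
  rewrite -setXI; exists (X1 `&` Y1); split; first exact: measurableI.
  by exists (X2 `&` Y2); split => //; exact: measurableI.
- move=> n; exists setT; split => //.
  by exists setT; split => //; rewrite setXTT.
- by rewrite bigcup_const.
- by move=> _ [A [mA [B [mB ->]]]]; exact: PQ.
- by move=> n; apply: le_lt_trans (ltry 1); exact: probability_le1.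
Qed.

Lemma eq_measure_null d (E : measurableType d) (R : realType)
    (m : {measure set E -> \bar R}) (Z C D : set E) :
  measurable Z -> measurable C -> measurable D -> m Z = 0%E ->
  (forall x, ~ Z x -> C x <-> D x) -> m C = m D.
Proof.
move=> mZ mC mD Z0 CD.
rewrite (measureDI m mC mZ) (measureDI m mD mZ).
have null A : measurable A -> m (A `&` Z) = 0%E.
  by move=> mA; apply: (subset_measure0 _ mZ) => //; exact: measurableI.
congr (_ + _)%E; last by rewrite [LHS]null// [RHS]null.
congr (m _).
by apply/seteqP; split => x [? Zx]; split => //; exact/(CD _ Zx).
Qed.

(** * Negative powers and the gamma density *)

Lemma negpowE (R : realType) (nu y : R) : 0 < nu ->
  negpow nu y = if y == 0 then +oo%E else (y `^ (- nu))%:E.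
Proof.
move=> nu0; rewrite /negpow inver powR_eq0 (gt_eqF nu0) andbT.
by case: ifPn => // y0; rewrite powRN.
Qed.

Lemma negpow_ge0 (R : realType) (nu y : R) : (0 <= negpow nu y)%E.
Proof.
rewrite /negpow inver; case: ifPn => // _.
by rewrite lee_fin invr_ge0 powR_ge0.
Qed.

Lemma neg_moment_ge0 d (T : measurableType d) (R : realType)
    (P : probability T R) (nu : R) (Y : T -> R) : (0 <= neg_moment P nu Y)%E.
Proof. by apply: integral_ge0 => t _; exact: negpow_ge0. Qed.

Lemma measurable_negpow (R : realType) (nu : R) : 0 < nu ->
  measurable_fun setT (negpow nu).
Proof.
move=> nu0.
rewrite (_ : negpow nu = fun y =>
    if y == 0 then +oo%E else (y `^ (- nu))%:E); last first.
  by apply/funext => y; rewrite negpowE.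
apply: measurable_fun_ifT => //.
- exact: measurable_fun_eqr.
- by apply/measurable_EFinP; exact: measurable_powR.
Qed.

Lemma measurable_gamma_pdf (R : realType) (nu : R) :
  measurable_fun setT (gamma_pdf nu).
Proof.
apply: measurable_fun_ifT => //.
- exact: measurable_fun_ltr.
- apply: measurable_funM => //; apply: measurable_funM.
    exact: measurable_powR.
  exact: (measurableT_comp (@measurable_expR R) (@oppr_measurable R _)).
Qed.

Lemma Gamma_fun_ge0 (R : realType) (nu : R) : 0 <= Gamma_fun nu.
Proof.
rewrite fine_ge0//; apply: integral_ge0 => t _.
by rewrite lee_fin mulr_ge0 ?powR_ge0 ?expR_ge0.
Qed.

Lemma gamma_pdf_ge0 (R : realType) (nu t : R) : 0 <= gamma_pdf nu t.
Proof.
rewrite /gamma_pdf; case: ifPn => // t0.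
by rewrite divr_ge0 ?Gamma_fun_ge0// mulr_ge0 ?powR_ge0 ?expR_ge0.
Qed.

Lemma fine_neq0_EFin (R : realType) (x : \bar R) :
  fine x != 0 -> x = (fine x)%:E.
Proof. by case: x => //=; rewrite eqxx. Qed.

Lemma integral_gamma_pdf (R : realType) (nu : R) : Gamma_fun nu != 0 ->
  (\int[lebesgue_measure]_t (gamma_pdf nu t)%:E = 1)%E.
Proof.
move=> G0.
transitivity (\int[lebesgue_measure]_(t in `]0%R, +oo[)
    ((t `^ (nu - 1) * expR (- t))%:E * ((Gamma_fun nu)^-1)%:E))%E.
  rewrite [RHS]integral_mkcond; apply: eq_integral => t _.
  rewrite patchE mem_setE in_itv/= andbT /gamma_pdf.
  by case: ifPn.
rewrite ge0_integralZr//.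
- by rewrite (fine_neq0_EFin G0) -EFinM divff.
- apply/measurable_EFinP; apply: measurable_funM.
    by apply: measurable_funTS; exact: measurable_powR.
  apply: measurable_funTS.
  exact: (measurableT_comp (@measurable_expR R) (@oppr_measurable R _)).
- by move=> t _; rewrite lee_fin mulr_ge0 ?powR_ge0 ?expR_ge0.
- by rewrite lee_fin invr_ge0 Gamma_fun_ge0.
Qed.

(** * The polynomial tilt *)

Section polynomial_tilt.
Context d (E : measurableType d) (R : realType) (P : probability E R).
Variables (w : E -> R) (nu : R).
Hypotheses (mw : measurable_fun setT w) (w_ge0 : forall x, 0 <= w x).
Hypothesis nu_gt0 : 0 < nu.
Local Notation c := (fine (neg_moment P nu w)).
Hypothesis c_neq0 : c != 0.

Lemma measurable_negpow_comp : measurable_fun setT (fun x => negpow nu (w x)).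
Proof. by apply: measurableT_comp => //; exact: measurable_negpow. Qed.

(** [negpow nu] is infinite at [0], so a finite moment leaves no mass there;
    and [c != 0] makes the moment finite, as [fine] sends infinity to [0]. *)
Lemma neg_moment_ae_gt0 : {ae P, forall x, 0 < w x}.
Proof.
have /integrable_ae : P.-integrable setT (fun x => negpow nu (w x)).
  apply/integrableP; split; first exact: measurable_negpow_comp.
  under eq_integral do rewrite gee0_abs ?negpow_ge0//.
  by rewrite -/(neg_moment P nu w) (fine_neq0_EFin c_neq0) ltry.
move=> /(_ measurableT); apply: filterS => x /(_ I).
by rewrite negpowE// lt_neqAle w_ge0 andbT eq_sym; case: ifPn.
Qed.

(** A real-valued version of [negpow nu (w x) / c]: the two differ only where
    [w x = 0], where the powers are [0] and [+oo] respectively. *)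
Definition tilt_pdf x : R := w x `^ (- nu) / c.

Lemma tilt_pdf_ge0 x : 0 <= tilt_pdf x.
Proof.
by rewrite divr_ge0 ?powR_ge0// fine_ge0// neg_moment_ge0.
Qed.

Lemma measurable_tilt_pdf : measurable_fun setT tilt_pdf.
Proof.
apply: measurable_funM => //.
exact: (measurableT_comp (@measurable_powR R (- nu)) mw).
Qed.

Lemma integral_tilt_pdfE (A : set E) : measurable A ->
  (\int[P]_(x in A) (negpow nu (w x) * (c^-1)%:E) =
   \int[P]_(x in A) (tilt_pdf x)%:E)%E.
Proof.
move=> mA; apply: ae_eq_integral => //.
- apply: emeasurable_funM => //; apply: measurable_funTS.
  exact: measurable_negpow_comp.
- apply/measurable_EFinP; apply: measurable_funTS.
  exact: measurable_tilt_pdf.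
- apply: filterS neg_moment_ae_gt0 => x wx _.
  by rewrite negpowE// gt_eqF.
Qed.

Lemma integral_tilt_pdf : (\int[P]_x (tilt_pdf x)%:E = 1)%E.
Proof.
rewrite -integral_tilt_pdfE// ge0_integralZr//.
- by rewrite -/(neg_moment P nu w) (fine_neq0_EFin c_neq0) -EFinM divff.
- exact: measurable_negpow_comp.
- by move=> x _; exact: negpow_ge0.
- by rewrite lee_fin invr_ge0 fine_ge0// neg_moment_ge0.
Qed.

End polynomial_tilt.

(** * The joint law of the tilted variable and its gamma scale *)

Section gamma_mixture.
Context d (E : measurableType d) (R : realType) (P : probability E R).
Variables (w : E -> R) (nu : R).
Hypotheses (mw : measurable_fun setT w) (w_ge0 : forall x, 0 <= w x).
Hypothesis nu_gt0 : 0 < nu.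
Local Notation c := (fine (neg_moment P nu w)).
Local Notation G := (Gamma_fun nu).
Hypotheses (c_neq0 : c != 0) (G_neq0 : G != 0).

Let tilted : probability E R :=
  density_prob (measurable_tilt_pdf P nu mw) (tilt_pdf_ge0 P w nu)
    (integral_tilt_pdf mw w_ge0 nu_gt0 c_neq0).

Let gamma : probability (measurableTypeR R) R :=
  @density_prob _ (measurableTypeR R) R lebesgue_measure (gamma_pdf nu)
    (measurable_gamma_pdf nu) (gamma_pdf_ge0 nu)
    (integral_gamma_pdf G_neq0).

Definition rescale (x : E * R) : E * R := (x.1, x.2 * w x.1).
Definition unscale (x : E * R) : E * R := (x.1, x.2 * w x.1 `^ (- 1)).

Lemma measurable_rescale : measurable_fun setT rescale.
Proof.
apply: measurable_fun_pair => //; apply: measurable_funM => //.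
exact: measurableT_comp.
Qed.

Lemma measurable_unscale : measurable_fun setT unscale.
Proof.
apply: measurable_fun_pair => //; apply: measurable_funM => //.
exact: (measurableT_comp (@measurable_powR R (- 1))
  (measurableT_comp mw measurable_fst)).
Qed.

Lemma rescaleK x : 0 < w x.1 -> unscale (rescale x) = x.
Proof.
case: x => x s /= wx; congr (_, _) => /=.
by rewrite powR_inv1// mulfK// gt_eqF.
Qed.

Lemma unscaleK x : 0 < w x.1 -> rescale (unscale x) = x.
Proof.
case: x => x s /= wx; congr (_, _) => /=.
by rewrite powR_inv1// mulfVK// gt_eqF.
Qed.

(** [mix_weight s * expR (- s * w x)] is the joint density of [(X, xi)] with
    respect to [P(dx) ds]. *)
Definition mix_weight (s : R) : R :=
  if 0 < s then s `^ (nu - 1) / (c * G) else 0.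

Lemma mix_weight_ge0 s : 0 <= mix_weight s.
Proof.
rewrite /mix_weight; case: ifPn => // _.
by rewrite divr_ge0 ?powR_ge0// mulr_ge0 ?Gamma_fun_ge0// fine_ge0//
  neg_moment_ge0.
Qed.

Lemma measurable_mix_weight : measurable_fun setT mix_weight.
Proof.
apply: measurable_fun_ifT => //.
- exact: measurable_fun_ltr.
- by apply: measurable_funM => //; exact: measurable_powR.
Qed.

(** The substitution [z = s * a] has Jacobian [a], and [a * a^(nu-1)] cancels
    the tilt [a^-nu]. *)
Lemma mix_weight_expE a s : 0 < a ->
  a * gamma_pdf nu (s * a) * (a `^ (- nu) / c) = mix_weight s * expR (- s * a).
Proof.
move=> a0; rewrite /gamma_pdf /mix_weight pmulr_lgt0//.
case: ifPn => s0; last by rewrite mulr0 !mul0r.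
rewrite powRM ?ltW// mulNr powRN -(mulr_powRB1 (ltW a0) nu_gt0).
have an0 : a `^ (nu - 1) != 0 by rewrite gt_eqF// powR_gt0.
have ax0 : a != 0 by rewrite gt_eqF.
set u := s `^ _; set v := a `^ _ in an0 *.
set e := expR _; move: c_neq0 G_neq0 => c0 G0.
set k := fine _ in c0 *; set g := Gamma_fun nu in G0 *.
clearbody u v e k g.
by field; rewrite c0 G0 an0 ax0.
Qed.

Lemma measurable_expRw :
  measurable_fun setT (fun x : E * R => expR (- x.2 * w x.1)).
Proof.
apply: (measurableT_comp (@measurable_expR R)).
apply: measurable_funM; last exact: measurableT_comp.
exact: measurableT_comp.
Qed.

(** Substitute [z = s * w x] in the inner integral at fixed [x], then exchange
    the order of integration. *)
Lemma tilted_gamma_unscale (A : set E) (B : set R) :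
  measurable A -> measurable B ->
  ((tilted \x gamma) (unscale @^-1` (A `*` B)) =
   \int[lebesgue_measure]_(s in B)
     ((mix_weight s)%:E * \int[P]_(x in A) (expR (- s * w x))%:E))%E.
Proof.
move=> mA mB.
pose C := unscale @^-1` (A `*` B).
have mC : measurable C.
  rewrite -[C]setTI; apply: measurable_unscale => //.
  exact: measurableX.
pose F (x : E * R) : \bar R := (\1_C x * gamma_pdf nu x.2)%:E.
have mF : measurable_fun setT F.
  apply/measurable_EFinP; apply: measurable_funM => //.
  exact: (measurableT_comp (@measurable_gamma_pdf R nu)).
have F0 x : (0 <= F x)%E by rewrite lee_fin mulr_ge0// gamma_pdf_ge0.
pose K (x : E * R) : \bar R :=
  (\1_A x.1 * \1_B x.2 * (mix_weight x.2 * expR (- x.2 * w x.1)))%:E.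
have mK : measurable_fun setT K.
  apply/measurable_EFinP; apply: measurable_funM => //.
    by apply: measurable_funM => //; exact: measurableT_comp.
  apply: measurable_funM => //; last exact: measurable_expRw.
  exact: (measurableT_comp measurable_mix_weight).
have K0 x : (0 <= K x)%E.
  by rewrite lee_fin !mulr_ge0// ?mix_weight_ge0 ?expR_ge0.
transitivity (\int[tilted]_x \int[lebesgue_measure]_z F (x, z))%E.
  apply: eq_integral => x _ /=; rewrite /gamma/= /density_prob/=.
  rewrite integral_mkcond; apply: eq_integral => z _.
  rewrite epatch_indic/= /F/= EFinM muleC; congr (_ * _)%E.
  by rewrite !indicE mem_xsection.
have mFF := @measurable_fun_fubini_tonelli_F _ _ _ _ _
  (@lebesgue_measure R) _ mF.
rewrite (@ge0_integral_density _ _ _ tilted P (tilt_pdf P w nu))//;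
  last 4 first.
- exact: measurable_tilt_pdf.
- exact: tilt_pdf_ge0.
- exact: mFF.
- by move=> x; apply: integral_ge0.
transitivity (\int[P]_x \int[lebesgue_measure]_s K (x, s))%E.
  apply: ae_eq_integral => //.
  - apply: emeasurable_funM; first exact: mFF.
    by apply/measurable_EFinP; exact: measurable_tilt_pdf.
  - exact: (@measurable_fun_fubini_tonelli_F _ _ _ _ _
      (@lebesgue_measure R) _ mK).
  apply: filterS (neg_moment_ae_gt0 mw w_ge0 nu_gt0 c_neq0) => x wx _.
  have mFx : measurable_fun setT (fun z => F (x, z)).
    have mx : measurable_fun setT (fun z : R => (x, z)).
      exact: pair1_measurable.
    exact: (measurableT_comp mF mx).
  rewrite (ge0_integral_scale wx mFx)// muleAC -EFinM.
  rewrite -ge0_integralZl//; last 2 first.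
  - have ms : measurable_fun setT (fun s : R => s * w x).
      exact: mulrr_measurable.
    exact: (measurableT_comp mFx ms).
  - by rewrite lee_fin mulr_ge0 ?tilt_pdf_ge0.
  apply: eq_integral => s _.
  rewrite /F /K/= -EFinM -mix_weight_expE// /tilt_pdf; congr (_%:E).
  have -> : \1_C (x, s * w x) = \1_A x * \1_B s :> R.
    rewrite -[RHS]/((\1_A x : R) * \1_B s) !indicE -natrM mulnb; congr (_%:R).
    congr nat_of_bool; rewrite /C.
    rewrite -[LHS]/(unscale (rescale (x, s)) \in A `*` B) rescaleK//.
    by rewrite in_setX.
  by ring.
rewrite (@fubini_tonelli _ _ E (measurableTypeR R) R P lebesgue_measure K)//.
rewrite [RHS]integral_mkcond; apply: eq_integral => s _.
rewrite epatch_indic/=.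
transitivity (\int[P]_x ((\1_B s * mix_weight s)%:E *
    ((\1_A x)%:E * (expR (- s * w x))%:E)))%E.
  apply: eq_integral => x _; rewrite /K/= -!EFinM; congr (_%:E).
  by ring.
have me : measurable_fun setT (fun x => (expR (- s * w x))%:E).
  apply/measurable_EFinP; apply: (measurableT_comp (@measurable_expR R)).
  exact: measurable_funM.
rewrite ge0_integralZl//; last 2 first.
- by apply: emeasurable_funM => //; exact/measurable_EFinP.
- by rewrite lee_fin mulr_ge0 ?mix_weight_ge0.
rewrite [in LHS]mulrC EFinM muleAC; congr (_ * _ * _)%E.
rewrite [RHS]integral_mkcond; apply: eq_integral => x _.
by rewrite epatch_indic/= muleC.
Qed.

Let null := w @^-1` [set 0].

Let mnull : measurable null.
Proof. by rewrite -[null]setTI; exact: mw. Qed.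

Let tilted_null : tilted null = 0%E.
Proof.
apply: integral0_eq => x wx0.
have -> : tilt_pdf P w nu x = 0; last by [].
by rewrite /tilt_pdf wx0 powR0 ?mul0r// oppr_eq0 gt_eqF.
Qed.

Let notnull x : ~ null x -> 0 < w x.
Proof. by move/eqP; rewrite lt_neqAle w_ge0 eq_sym => ->. Qed.

(** [rescale] and [unscale] are inverse to each other off [{w = 0}], which is
    null for the law of [X] under either description. *)
Lemma gamma_mixtureP dT (T : measurableType dT) (Pr : probability T R)
    (X : T -> E) (xi : T -> R) :
  measurable_fun setT X -> measurable_fun setT xi ->
  (forall A B, measurable A -> measurable B ->
    Pr (X @^-1` A `&` (fun t => xi t * w (X t)) @^-1` B) =
    ((\int[P]_(x in A) (tilt_pdf P w nu x)%:E) *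
     (\int[lebesgue_measure]_(z in B) (gamma_pdf nu z)%:E))%E) <->
  (forall A B, measurable A -> measurable B ->
    Pr (X @^-1` A `&` xi @^-1` B) =
    (\int[lebesgue_measure]_(s in B)
     ((mix_weight s)%:E * \int[P]_(x in A) (expR (- s * w x))%:E))%E).
Proof.
move=> mX mxi.
have mU : @measurable_fun _ _ T (E * measurableTypeR R)%type setT
    (fun t => (X t, xi t)) by exact: measurable_fun_pair.
pose U : {mfun T >-> (E * measurableTypeR R)%type} :=
  HB.pack (fun t => (X t, xi t)) (isMeasurableFun.Build _ _ _ _ _ mU).
have mV : @measurable_fun _ _ T (E * measurableTypeR R)%type setT
    (fun t => rescale (X t, xi t)).
  exact: (measurableT_comp measurable_rescale mU).
pose V : {mfun T >-> (E * measurableTypeR R)%type} :=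
  HB.pack (fun t => rescale (X t, xi t)) (isMeasurableFun.Build _ _ _ _ _ mV).
have mS : @measurable_fun _ _ (E * measurableTypeR R)%type
  (E * measurableTypeR R)%type setT unscale by exact: measurable_unscale.
pose S : {mfun (E * measurableTypeR R)%type >-> (E * measurableTypeR R)%type} :=
  HB.pack unscale (isMeasurableFun.Build _ _ _ _ _ mS).
split=> H A B mA mB.
- have law C : measurable C -> distribution Pr V C = (tilted \x gamma)%E C.
    move: C.
    apply: (@eq_probability_prod _ _ E (measurableTypeR R)) => A' B' mA' mB'.
    transitivity (tilted A' * gamma B')%E; first exact: H.
    by apply/esym; exact: product_measure1E.
  have mAB : measurable (unscale @^-1` (A `*` B)).
    rewrite -[X in measurable X]setTI; apply: measurable_unscale => //.
    exact: measurableX.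
  rewrite -tilted_gamma_unscale// -law//.
  apply: (@eq_measure_null _ _ _ _ (X @^-1` null)).
  - by rewrite -[X in measurable X]setTI; exact: mX.
  - apply: measurableI; rewrite -[X in measurable X]setTI.
    + exact: mX.
    + exact: mxi.
  - by rewrite -[X in measurable X]setTI; exact: (mV).
  - have := H null setT mnull measurableT.
    by rewrite preimage_setT setIT [X in (X * _)%E]tilted_null mul0e.
  - move=> t /notnull wt.
    rewrite -[X in _ <-> X]/((A `*` B) (unscale (rescale (X t, xi t)))).
    by rewrite rescaleK.
- have law C : measurable C ->
      distribution Pr U C = pushforward (tilted \x gamma)%E S C.
    move: C.
    apply: (@eq_probability_prod _ _ E (measurableTypeR R)) => A' B' mA' mB'.
    by rewrite [RHS]tilted_gamma_unscale//; exact: H.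
  have mAB : measurable (rescale @^-1` (A `*` B)).
    rewrite -[X in measurable X]setTI; apply: measurable_rescale => //.
    exact: measurableX.
  transitivity (distribution Pr U (rescale @^-1` (A `*` B))); first by [].
  rewrite law//.
  transitivity ((tilted \x gamma)%E (A `*` B)); last first.
    by rewrite product_measure1E.
  pose rho : {measure set (E * measurableTypeR R)%type -> \bar R} :=
    (tilted \x gamma)%E.
  apply: (@eq_measure_null _ _ _ rho (null `*` setT)
    (S @^-1` (rescale @^-1` (A `*` B))) (A `*` B)).
  - exact: measurableX.
  - by rewrite -[X in measurable X]setTI; exact: (mS measurableT _ mAB).
  - exact: measurableX.
  - by rewrite /= product_measure1E// [X in (X * _)%E]tilted_null mul0e.
  - move=> x nx; rewrite -[X in X <-> _]/((A `*` B) (rescale (unscale x))).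
    by rewrite unscaleK//; apply: notnull => ?; apply: nx.
Qed.

End gamma_mixture.

(** * Densities that depend on a statistic only *)

(** Under the law of [w] for [PN], both [h] and [g * h0] are densities of the
    law of [w] for [P], so they agree almost everywhere; composing with [w],
    the two densities of [P] and of [g (w x) P0(dx)] with respect to [PN]
    agree as well. *)
Lemma has_density_lift d (E : measurableType d) (R : realType)
    (PN P0 P : probability E R) (w : {mfun E >-> R}) (h0 h : R -> R)
    (g : R -> \bar R) :
  measurable_fun setT h0 -> measurable_fun setT h -> measurable_fun setT g ->
  (forall t, 0 <= h0 t) -> (forall t, 0 <= h t) -> (forall t, 0 <= g t)%E ->
  has_density P0 PN (fun x => (h0 (w x))%:E) ->
  has_density P PN (fun x => (h (w x))%:E) ->
  (forall A, measurable A ->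
    P (w @^-1` A) = (\int[P0]_(x in w @^-1` A) g (w x))%E) ->
  has_density P P0 (fun x => g (w x)).
Proof.
move=> mh0 mh mg h00 hge0 g0 d0 d1 law.
have mw : measurable_fun setT w by [].
have mw1 A : measurable A -> measurable (w @^-1` A).
  by move=> mA; rewrite -[X in measurable X]setTI; exact: mw.
pose gh0 t := (g t * (h0 t)%:E)%E.
have mgh0 : measurable_fun setT gh0.
  by apply: emeasurable_funM => //; exact/measurable_EFinP.
have gh0_ge0 t : (0 <= gh0 t)%E by rewrite mule_ge0// lee_fin.
have mhE : measurable_fun setT (EFin \o h) by exact/measurable_EFinP.
have P0E A : measurable A -> (\int[P0]_(x in A) g (w x) =
    \int[PN]_(x in A) gh0 (w x))%E.
  move=> mA; apply: (@ge0_integral_density _ _ _ P0 PN (h0 \o w)) => //.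
  - exact: measurableT_comp.
  - by move=> x; exact: h00.
  - apply: measurable_funTS; exact: (measurableT_comp mg mw).
have LE (f : R -> \bar R) A : measurable_fun setT f -> (forall t, 0 <= f t)%E ->
    measurable A -> (\int[distribution PN w]_(t in A) f t =
      \int[PN]_(x in w @^-1` A) f (w x))%E.
  move=> mf f0 mA; rewrite ge0_integral_pushforward//.
  exact: measurable_funTS.
have ae : ae_eq (distribution PN w) setT (EFin \o h) gh0.
  apply: integral_ae_eq => //.
  - apply/integrableP; split => //.
    under eq_integral do rewrite /= ger0_norm//.
    rewrite (LE (EFin \o h))//.
    rewrite preimage_setT -d1//.
    by apply: le_lt_trans (ltry 1); exact: probability_le1.
  - move=> A _ mA; rewrite LE//.
    rewrite -d1 ?law; [|exact: mA|exact: mw1].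
    by rewrite P0E ?LE//; exact: mw1.
case: ae => Z [mZ Z0 hZ] A mA.
rewrite d1// P0E//.
apply: ae_eq_integral => //.
- apply: measurable_funTS; exact: (measurableT_comp mhE mw).
- apply: measurable_funTS; exact: (measurableT_comp mgh0 mw).
- exists (w @^-1` Z); split => //; first exact: mw1.
  by move=> x /= nx; apply: hZ => /= hx; apply: nx => _; exact: hx.
Qed.

(** * Laplace transform and exponential tilt *)

Section laplace.
Context d (E : measurableType d) (R : realType) (P : probability E R).
Variable (w : E -> R).
Hypotheses (mw : measurable_fun setT w) (w_ge0 : forall x, 0 <= w x).
Local Notation psi := (cumulant P w).

Let mexpw s : measurable_fun setT (fun x => expR (- s * w x)).
Proof.
by apply: (measurableT_comp (@measurable_expR R)); exact: measurable_funM.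
Qed.

(** For [0 <= s] the transform lies in [(0, 1]], so that [fine] and [ln] in the
    definition of the cumulant lose nothing. *)
Lemma laplace_cumulant s : 0 <= s ->
  (\int[P]_x (expR (- s * w x))%:E = (expR (- psi s))%:E)%E.
Proof.
move=> s0; rewrite /cumulant opprK unlock.
set L := (\int[P]_x _)%E.
have L0 : (0 <= L)%E by apply: integral_ge0 => x _; rewrite lee_fin expR_ge0.
have L1 : (L <= 1)%E.
  apply: (@le_trans _ _ (\int[P]_x 1)%E); last first.
    by rewrite integral_cst// mul1e; exact: probability_le1.
  apply: ge0_le_integral => //.
  - by apply/measurable_EFinP; exact: (mexpw s).
  - by move=> x _; rewrite lee_fin expR_le1 mulNr oppr_le0 mulr_ge0.
have Lfin : L \is a fin_num.
  by rewrite ge0_fin_numE// (le_lt_trans L1)// ltry.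
have L_neq0 : L != 0%E.
  apply/eqP => L_eq0.
  have : ae_eq P setT (fun x => (expR (- s * w x))%:E) (cst 0%E).
    apply/ae_eq_integral_abs => //.
      by apply/measurable_EFinP; exact: (mexpw s).
    under eq_integral do rewrite gee0_abs ?lee_fin ?expR_ge0//.
    exact: L_eq0.
  case=> Z [mZ Z0 sZ].
  have ZT : Z = setT.
    apply/seteqP; split => // x _; apply: sZ => /= /(_ I) [].
    by apply/eqP; rewrite gt_eqF// expR_gt0.
  by have := probability_setT P; rewrite -ZT Z0 => /esym/eqP; rewrite onee_eq0.
rewrite lnK ?fineK//.
rewrite posrE fine_gt0// lt_neqAle eq_sym L_neq0 L0/=.
by rewrite (le_lt_trans L1)// ltry.
Qed.

Lemma measurable_laplace (A : set E) : measurable A ->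
  measurable_fun setT (fun s : R => \int[P]_(x in A) (expR (- s * w x))%:E)%E.
Proof.
move=> mA.
pose F (x : R * E) := (\1_A x.2 * expR (- x.1 * w x.2))%:E.
rewrite (_ : (fun s => _) = fun s => \int[P]_x F (s, x))%E; last first.
  apply/funext => s; rewrite [LHS]integral_mkcond; apply: eq_integral => x _.
  by rewrite epatch_indic/= /F/= EFinM muleC.
apply: (@measurable_fun_fubini_tonelli_F _ _ _ _ _ P F).
  apply/measurable_EFinP; apply: measurable_funM.
    have mI : measurable_fun setT (\1_A : E -> R) by exact: measurable_indic.
    exact: (measurableT_comp mI measurable_snd).
  apply: (measurableT_comp (@measurable_expR R)).
  apply: measurable_funM; last exact: (measurableT_comp mw measurable_snd).
  exact: (measurableT_comp (@oppr_measurable R setT) measurable_fst).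
by move=> x; rewrite lee_fin mulr_ge0 ?expR_ge0.
Qed.

(** The exponent is truncated at [0] to get a probability for every real [s]:
    for [s < 0] the exponential moment may be infinite. *)
Definition exp_pdf s x : R := expR (psi (Num.max s 0) - Num.max s 0 * w x).

Let max_ge0 (s : R) : 0 <= Num.max s 0. Proof. by rewrite le_max lexx orbT. Qed.

Lemma exp_pdf_ge0 s x : 0 <= exp_pdf s x. Proof. exact: expR_ge0. Qed.

Lemma measurable_exp_pdf s : measurable_fun setT (exp_pdf s).
Proof.
apply: (measurableT_comp (@measurable_expR R)).
by apply: measurable_funB => //; exact: measurable_funM.
Qed.

Lemma integral_exp_pdf s (A : set E) : measurable A ->
  (\int[P]_(x in A) (exp_pdf s x)%:E = (expR (psi (Num.max s 0)))%:E *
    \int[P]_(x in A) (expR (- Num.max s 0 * w x))%:E)%E.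
Proof.
move=> mA; rewrite -ge0_integralZl//.
- by apply: eq_integral => x _; rewrite -EFinM -expRD mulNr.
- by apply/measurable_EFinP; exact: measurable_funTS.
Qed.

Lemma integral_exp_pdfT s : (\int[P]_x (exp_pdf s x)%:E = 1)%E.
Proof.
by rewrite integral_exp_pdf// laplace_cumulant// -EFinM -expRD subrr expR0.
Qed.

Lemma measurable_cumulant_max :
  measurable_fun setT (fun s : R => psi (Num.max s 0)).
Proof.
have mmax : measurable_fun setT (fun s : R => Num.max s 0).
  exact: measurable_maxr.
rewrite (_ : (fun _ => _) = (fun s => - ln (fine
    (\int[P]_x (expR (- Num.max s 0 * w x))%:E)))); last first.
  by apply/funext => s; rewrite /cumulant unlock.
apply: measurableT_comp => //; apply: measurableT_comp => //.
apply: (measurableT_comp (@fine_measurable R setT measurableT)).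
exact: (measurableT_comp (measurable_laplace measurableT) mmax).
Qed.

Definition exp_kernel (s : R) : {measure set E -> \bar R} :=
  density_prob (measurable_exp_pdf s) (exp_pdf_ge0 s) (integral_exp_pdfT s).

Let measurable_exp_kernel U : measurable U ->
  measurable_fun setT (exp_kernel ^~ U).
Proof.
move=> mU.
have -> : (fun s => exp_kernel s U) =
    (fun s => (expR (psi (Num.max s 0)))%:E *
      \int[P]_(x in U) (expR (- Num.max s 0 * w x))%:E)%E.
  by apply/funext => s; exact: integral_exp_pdf.
apply: emeasurable_funM.
  apply/measurable_EFinP; apply: (measurableT_comp (@measurable_expR R)).
  exact: measurable_cumulant_max.
have mmax : measurable_fun setT (fun s : R => Num.max s 0).
  exact: measurable_maxr.
exact: (measurableT_comp (measurable_laplace mU) mmax).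
Qed.

HB.instance Definition _ :=
  isKernel.Build _ _ _ _ _ exp_kernel measurable_exp_kernel.
HB.instance Definition _ :=
  Kernel_isProbability.Build _ _ _ _ _ exp_kernel integral_exp_pdfT.

End laplace.

(** * Disintegration along the scale variable *)

Section disintegration.
Context d (E : measurableType d) (R : realType) (P : probability E R).
Variables (w : E -> R) (nu : R).
Hypotheses (mw : measurable_fun setT w) (w_ge0 : forall x, 0 <= w x).
Local Notation c := (fine (neg_moment P nu w)).
Local Notation G := (Gamma_fun nu).
Local Notation psi := (cumulant P w).

Definition mixing_pdf (s : R) : R :=
  if 0 < s then expR (- psi s) * s `^ (nu - 1) / (c * G) else 0.

Let pdfE s : mixing_pdf s = expR (- psi (Num.max s 0)) * mix_weight P w nu s.
Proof.
rewrite /mixing_pdf /mix_weight; case: ifPn => [s0|]; last by rewrite mulr0.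
by rewrite (max_idPl (ltW s0)) mulrA.
Qed.

Lemma mixing_pdf_ge0 s : 0 <= mixing_pdf s.
Proof. by rewrite pdfE mulr_ge0 ?expR_ge0 ?mix_weight_ge0. Qed.

Lemma measurable_mixing_pdf : measurable_fun setT mixing_pdf.
Proof.
rewrite (funext pdfE); apply: measurable_funM; last first.
  exact: measurable_mix_weight.
apply: (measurableT_comp (@measurable_expR R)).
apply: (measurableT_comp (@oppr_measurable R setT)).
exact: measurable_cumulant_max.
Qed.

Let mixE s A : measurable A -> (\int[P]_(x in A) (expR (psi s - s * w x))%:E *
     (mixing_pdf s)%:E =
  (mix_weight P w nu s)%:E * \int[P]_(x in A) (expR (- s * w x))%:E)%E.
Proof.
move=> mA; have [s0|s0] := ltP 0 s; last first.
  by rewrite /mixing_pdf /mix_weight ltNge s0/= mule0 mul0e.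
have := integral_exp_pdf P mw s mA.
rewrite /exp_pdf pdfE (max_idPl (ltW s0)) => ->.
by rewrite muleAC -EFinM mulrA -expRD subrr expR0 mul1r.
Qed.

(** The factor [exp (- psi s)] of the density of [xi] cancels the factor
    [exp (psi s)] of the exponential tilt, leaving the joint density
    [mix_weight s * expR (- s * w x)]. *)
Lemma conditional_law_mixtureP dT (T : measurableType dT)
    (Pr : probability T R) (X : {RV Pr >-> E}) (xi : {RV Pr >-> R}) :
  (forall A B, measurable A -> measurable B ->
    Pr (X @^-1` A `&` xi @^-1` B) =
    (\int[lebesgue_measure]_(s in B)
     ((mix_weight P w nu s)%:E * \int[P]_(x in A) (expR (- s * w x))%:E))%E) <->
  has_pdf (distribution Pr xi) mixing_pdf /\
  exists kappa : R.-pker R ~> E, regular_cond_law X xi kappa /\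
    {ae lebesgue_measure, forall s : R, 0 < s ->
      forall A, measurable A ->
        kappa s A = (\int[P]_(x in A) (expR (psi s - s * w x))%:E)%E}.
Proof.
have condE (kappa : R.-pker R ~> E) A B :
    has_pdf (distribution Pr xi) mixing_pdf ->
    {ae lebesgue_measure, forall s : R, 0 < s ->
      forall A, measurable A ->
        kappa s A = (\int[P]_(x in A) (expR (psi s - s * w x))%:E)%E} ->
    measurable A -> measurable B ->
    (\int[distribution Pr xi]_(s in B) kappa s A =
     \int[lebesgue_measure]_(s in B) ((mix_weight P w nu s)%:E *
       \int[P]_(x in A) (expR (- s * w x))%:E))%E.
  move=> xipdf kE mA mB.
  have mk : measurable_fun setT (kappa ^~ A) by exact: measurable_kernel.
  rewrite (ge0_integral_pdf _ _ xipdf)//; last 3 first.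
  - exact: measurable_mixing_pdf.
  - exact: mixing_pdf_ge0.
  - exact: measurable_funTS.
  apply: ae_eq_integral => //.
  - apply: emeasurable_funM; first exact: measurable_funTS.
    apply/measurable_EFinP; apply: measurable_funTS.
    exact: measurable_mixing_pdf.
  - apply: emeasurable_funM.
      apply/measurable_EFinP; apply: measurable_funTS.
      exact: measurable_mix_weight.
    apply: measurable_funTS; exact: measurable_laplace.
  - case: kE => Z [mZ Z0 kZ]; exists Z; split => // s /= ns.
    apply: kZ => /= ks; apply: ns => _.
    rewrite -mixE//; have [s0|s0] := ltP 0 s; first by rewrite ks.
    by rewrite /mixing_pdf ltNge s0/= !mule0.
split => [H|[xipdf [kappa [kcond kE]]] A B mA mB]; last first.
  by rewrite kcond//; exact: condE.
have xipdf : has_pdf (distribution Pr xi) mixing_pdf.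
  move=> B mB; have := H setT B measurableT mB.
  rewrite preimage_setT setTI => HB; apply: (etrans HB).
  apply: eq_integral => s _.
  rewrite pdfE /mix_weight; case: ifPn => s0; last by rewrite mul0e mulr0.
  by rewrite laplace_cumulant// ?ltW// (max_idPl (ltW s0)) -EFinM mulrC.
have kE : {ae lebesgue_measure, forall s : R, 0 < s ->
    forall A, measurable A -> exp_kernel P mw w_ge0 s A =
      (\int[P]_(x in A) (expR (psi s - s * w x))%:E)%E}.
  apply: aeW => s s0 A mA.
  by rewrite /= /density_prob /exp_pdf (max_idPl (ltW s0)).
split => //; exists (exp_kernel P mw w_ge0); split => // A B mA mB.
by rewrite H// condE.
Qed.

End disintegration.

(** * The characterization for a general size function *)

Section scaled_size.
Context d (E : measurableType d) (R : realType) (P : probability E R).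
Variables (w : E -> R) (nu : R).
Hypotheses (mw : measurable_fun setT w) (w_ge0 : forall x, 0 <= w x).
Hypothesis nu_gt0 : 0 < nu.
Local Notation c := (fine (neg_moment P nu w)).
Local Notation G := (Gamma_fun nu).
Local Notation psi := (cumulant P w).

(** When [c * G = 0], every density involved is identically [0], as division by
    [0] yields [0]; then both sides are false.  Otherwise both sides are
    descriptions of the same joint law, whose marginals are recovered by taking
    one of the two sets to be everything. *)
Lemma scaled_size_gammaP dT (T : measurableType dT)
    (Pr : probability T R) (X : {RV Pr >-> E}) (xi : {RV Pr >-> R}) :
  [/\ independent_rv Pr X (fun t => xi t * w (X t)),
      has_pdf (pushforward Pr (fun t => xi t * w (X t))) (gamma_pdf nu)
    & has_density (distribution Pr X) P
        (fun x => (negpow nu (w x) * (c^-1)%:E)%E)] <->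
  has_pdf (distribution Pr xi) (mixing_pdf P w nu) /\
  exists kappa : R.-pker R ~> E, regular_cond_law X xi kappa /\
    {ae lebesgue_measure, forall s : R, 0 < s ->
      forall A, measurable A ->
        kappa s A = (\int[P]_(x in A) (expR (psi s - s * w x))%:E)%E}.
Proof.
have no_null_pdf (Z : T -> R) f : (forall s, f s = 0) ->
    ~ has_pdf (pushforward Pr Z) f.
  move=> f0; apply: (@pushforward_density_neq0 _ _ _ Pr _ (measurableTypeR R)).
  by move=> s /=; rewrite f0.
have [cG0|] := eqVneq (c * G) 0.
  split=> [[_ Zgamma Xtilt]|[xipdf _]]; exfalso.
  - move/eqP: cG0; rewrite mulf_eq0 => /orP[] /eqP z0.
    + apply: pushforward_density_neq0 Xtilt => x.
      by rewrite z0 invr0 mule0.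
    + apply: no_null_pdf Zgamma => s; rewrite /gamma_pdf z0 invr0 mulr0.
      by case: ifP.
  - apply: no_null_pdf xipdf => s; rewrite /mixing_pdf cG0 invr0 mulr0.
    by case: ifP.
rewrite mulf_eq0 negb_or => /andP[c0 G0].
have mX : measurable_fun setT X by [].
have mxi : measurable_fun setT xi by [].
have condP := conditional_law_mixtureP P nu mw w_ge0 X xi.
have mixP := gamma_mixtureP mw w_ge0 nu_gt0 c0 G0 Pr mX mxi.
split=> [[indep Zgamma Xtilt]|/condP/mixP joint].
  apply/condP/mixP => A B mA mB.
  by rewrite -integral_tilt_pdfE// -Xtilt// -Zgamma//; exact: indep.
have lawX A : measurable A -> Pr (X @^-1` A) =
    (\int[P]_(x in A) (tilt_pdf P w nu x)%:E)%E.
  move=> mA; have := joint A setT mA measurableT.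
  by rewrite preimage_setT setIT integral_gamma_pdf// mule1.
have lawZ B : measurable B -> Pr ((fun t => xi t * w (X t)) @^-1` B) =
    (\int[lebesgue_measure]_(z in B) (gamma_pdf nu z)%:E)%E.
  move=> mB; have := joint setT B measurableT mB.
  by rewrite preimage_setT setTI integral_tilt_pdf// mul1e.
split=> [A B mA mB|B mB|A mA].
- by rewrite lawX// lawZ//; exact: joint.
- exact: lawZ.
- by rewrite integral_tilt_pdfE//; exact: lawX.
Qed.

End scaled_size.

(** * Random measures *)

Lemma integral_distribution_comp d (T : measurableType d) (R : realType)
    (P : probability T R) d' (E : measurableType d') (X : {RV P >-> E})
    (w : {mfun E >-> R}) (A : set R) (g : R -> \bar R) :
  measurable A -> measurable_fun setT g -> (forall t, 0 <= g t)%E ->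
  (\int[pushforward P (w \o X)]_(t in A) g t =
   \int[distribution P X]_(x in w @^-1` A) g (w x))%E.
Proof.
move=> mA mg g0; rewrite ge0_integral_pushforward//; last first.
  exact: measurable_funTS.
rewrite [RHS]ge0_integral_pushforward//.
  by rewrite -[X in measurable X]setTI; exact: (measurable_funPT w).
apply: measurable_funTS; exact: (measurableT_comp mg (measurable_funPT w)).
Qed.

Lemma neg_moment_distribution d (T : measurableType d) (R : realType)
    (P : probability T R) d' (E : measurableType d') (X : {RV P >-> E})
    (w : {mfun E >-> R}) (nu : R) : 0 < nu ->
  neg_moment (distribution P X) nu w = neg_moment P nu (w \o X).
Proof.
move=> nu0; rewrite /neg_moment ge0_integral_distribution//.
  by apply: measurableT_comp => //; exact: measurable_negpow.
by move=> x; exact: negpow_ge0.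
Qed.

Lemma cumulant_distribution d (T : measurableType d) (R : realType)
    (P : probability T R) d' (E : measurableType d') (X : {RV P >-> E})
    (w : {mfun E >-> R}) (s : R) :
  cumulant (distribution P X) w s = cumulant P (w \o X) s.
Proof.
rewrite /cumulant unlock ge0_integral_distribution//.
apply/measurable_EFinP; apply: (measurableT_comp (@measurable_expR R)).
exact: measurable_funM.
Qed.

Lemma mass_ge0 d (X : measurableType d) (R : realType) (m : fmeasT X R) :
  0 <= mass m.
Proof. by rewrite /mass fine_ge0. Qed.

Theorem theorem2 (R : realType)
  (Omega : ptopologicalType) (hOmega : polish_space R Omega)
  (mu : probability (borel Omega) R)
  (lam : R -> R)
  (lam_gt0 : forall t : R, 0 < t -> 0 < lam t)
  (lam_cont : {in `]0, +oo[, continuous lam})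
  (lam_int : (\int[lebesgue_measure]_(t in `]0%R, +oo[)
                (Num.min 1 t * lam t)%:E < +oo)%E)
  (dN : measure_display) (TN : measurableType dN) (PN : probability TN R)
  (N : {RV PN >-> fmeasT (borel Omega) R})
  (hN : poisson_random_measure lam mu N)
  (d0 : measure_display) (T0 : measurableType d0) (P0 : probability T0 R)
  (M0 : {RV P0 >-> fmeasT (borel Omega) R})
  (d : measure_display) (T : measurableType d) (P : probability T R)
  (M : {RV P >-> fmeasT (borel Omega) R})
  (h0 h : R -> R)
  (mh0 : measurable_fun setT h0) (mh : measurable_fun setT h)
  (h0_ge0 : forall x : R, 0 <= h0 x) (h_ge0 : forall x : R, 0 <= h x)
  (Eh0 : ('E_PN[fun t => h0 (total_mass N t)] = 1)%E)
  (Eh : ('E_PN[fun t => h (total_mass N t)] = 1)%E)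
  (hM0 : weighted_version h0 M0 N)
  (hM : weighted_version h M N)
  (nu : R) (nu_gt0 : 0 < nu)
  (hmom : (neg_moment P0 nu (total_mass M0) < +oo)%E)
  (xi : {RV P >-> R}) (xi_gt0 : forall t : T, 0 < xi t) :
  [/\ independent_rv P M (fun t => xi t * total_mass M t),
      has_pdf (pushforward P (fun t => xi t * total_mass M t)) (gamma_pdf nu)
    & forall A : set R, measurable A ->
        pushforward P (total_mass M) A
          = poly_tilt nu (total_mass M0) A]
  <->
  has_pdf (distribution P xi)
    (fun s => if 0 < s
              then expR (- cumulant P0 (total_mass M0) s) * s `^ (nu - 1)
                     / (fine (neg_moment P0 nu (total_mass M0))
                          * Gamma_fun nu)
              else 0)
  /\
  exists kappa : R.-pker R ~> fmeasT (borel Omega) R,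
    regular_cond_law M xi kappa /\
    {ae lebesgue_measure, forall s : R, 0 < s ->
       forall A : set (fmeasT (borel Omega) R), measurable A ->
         kappa s A = exp_tilt M0 s A}.
Proof.
pose w : {mfun fmeasT (borel Omega) R >-> R} := @mass _ (borel Omega) R.
pose Q0 : probability (fmeasT (borel Omega) R) R := distribution P0 M0.
have mw : measurable_fun setT w by [].
have w_ge0 m : 0 <= w m by exact: mass_ge0.
have cE : neg_moment Q0 nu w = neg_moment P0 nu (total_mass M0).
  exact: neg_moment_distribution.
have psiE s : cumulant Q0 w s = cumulant P0 (total_mass M0) s.
  exact: cumulant_distribution.
pose c := fine (neg_moment Q0 nu w).
pose g (t : R) := (negpow nu t * (c^-1)%:E)%E.
have mg : measurable_fun setT g.
  by apply: emeasurable_funM => //; exact: measurable_negpow.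
have g0 t : (0 <= g t)%E.
  by rewrite mule_ge0 ?negpow_ge0// lee_fin invr_ge0 fine_ge0// neg_moment_ge0.
have tiltE A : measurable A -> poly_tilt nu (total_mass M0) A =
    (\int[Q0]_(m in w @^-1` A) g (w m))%E.
  move=> mA; rewrite /poly_tilt -cE.
  exact: (integral_distribution_comp M0 w mA mg g0).
(* (iii) constrains the law of the mass only; the weights extend it to the law
   of the whole random measure. *)
have sizeP : (forall A : set R, measurable A ->
      pushforward P (total_mass M) A = poly_tilt nu (total_mass M0) A) <->
    has_density (distribution P M) Q0 (fun m => g (w m)).
  split=> [size|dens A mA]; last first.
    rewrite tiltE// -dens//.
    by rewrite -[X in measurable X]setTI; exact: mw.
  apply: (has_density_lift (h0 := h0) (h := h) (PN := distribution PN N)) => //.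
  by move=> A mA; rewrite -tiltE// -size.
have pdfE : (fun s => if 0 < s
              then expR (- cumulant P0 (total_mass M0) s) * s `^ (nu - 1)
                     / (fine (neg_moment P0 nu (total_mass M0))
                          * Gamma_fun nu)
              else 0) = mixing_pdf Q0 w nu.
  by apply/funext => s; rewrite /mixing_pdf psiE cE.
have expE : exp_tilt M0 = fun s A =>
    (\int[Q0]_(m in A) (expR (cumulant Q0 w s - s * w m))%:E)%E.
  by apply/funext => s; apply/funext => A; rewrite psiE.
rewrite pdfE expE.
have core := scaled_size_gammaP Q0 mw w_ge0 nu_gt0 M xi.
split=> [[indep Zgamma /sizeP dens]|/core.2[indep Zgamma /sizeP size]].
  exact: (core.1 (And3 indep Zgamma dens)).
exact: And3 indep Zgamma size.
Qed.
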